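(* Let $G$ be a locally compact group with a local right action on a locally compact space $X$, defined on the open set $\Gamma\subseteq X\times G$. Let $f\in C_c(X)$ and $p\in G$. Define a function $p\cdot f$ on $X$ by $$(p\cdot f)(x)=\begin{cases} f(x\cdot p)&\text{if }(x,p)\in\Gamma,\\ 0&\text{otherwise.}\end{cases}$$ Let $C$ be the support of $f$. If $(x,p^{-1})\in\Gamma$ for all $x\in C$, then $p\cdot f$ is continuous with compact support, and its support is equal to the set of points $x\in X$ satisfying $(x,p)\in\Gamma$ and $x\cdot p\in C$.
   Context: Locally compact groups and spaces are Hausdorff. $e$ is the identity of $G$. $C_c(X)$ is the space of continuous complex functions on $X$ with compact support; the support is the closure of the set where the function is non-zero. Local right action of $G$ on $X$: a continuous map $(x,p)\mapsto x\cdot p$ from an open subset $\Gamma\subseteq X\times G$ to $X$ such that (i) $(x,e)\in\Gamma$ and $x\cdot e=x$ for all $x\in X$; (ii) for $(x,p)\in\Gamma$ and $q\in G$: $(x,pq)\in\Gamma$ if and only if $(x\cdot p,q)\in\Gamma$, and in that case $x\cdot(pq)=(x\cdot p)\cdot q$. *)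

(* Defs.v *)
From HB Require Import structures.
From mathcomp Require Import all_boot all_order all_algebra complex.
From mathcomp Require Import all_classical all_reals all_analysis.

Set Implicit Arguments.
Unset Strict Implicit.
Unset Printing Implicit Defensive.

Import numFieldNormedType.Exports.

Local Open Scope classical_set_scope.
Local Open Scope complex_scope.
Local Open Scope ring_scope.

HB.mixin Record isTopologicalGroup G & Topological G & Group G := {
  mulg_continuous : continuous (fun z : G * G => (z.1 * z.2)%g) ;
  invg_continuous : continuous (fun p : G => p^-1%g)
}.

#[short(type="topologicalGroupType")]
HB.structure Definition TopologicalGroup :=
  {G of Topological G & Group G & isTopologicalGroup G}.

(* [act x p] stands for x . p; it is total in Rocq, but nothing is required of
   its values at the pairs (x, p) outside [Gamma]. *)
Record local_right_action (X : topologicalType) (G : topologicalGroupType)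
    (Gamma : set (X * G)) (act : X -> G -> X) : Prop := LocalRightAction {
  lra_open : open Gamma ;
  lra_continuous : {within Gamma, continuous (fun z : X * G => act z.1 z.2)} ;
  lra_dom1 : forall x, Gamma (x, 1%g) ;
  lra_act1 : forall x, act x 1%g = x ;
  lra_domM : forall x p q, Gamma (x, p) ->
    (Gamma (x, (p * q)%g) <-> Gamma (act x p, q)) ;
  lra_actM : forall x p q, Gamma (x, p) -> Gamma (x, (p * q)%g) ->
    act x (p * q)%g = act (act x p) q
}.

(* The alias [R[i]^o] carries the topology given by the modulus on the complex
   numbers [R[i]]. *)
Definition supp (R : realType) (X : topologicalType) (f : X -> R[i]^o) : set X :=
  closure [set x | f x != 0].

Definition Cc (R : realType) (X : topologicalType) (f : X -> R[i]^o) : Prop :=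
  continuous f /\ compact (supp f).

Definition translate (R : realType) (X : topologicalType)
    (G : topologicalGroupType) (Gamma : set (X * G)) (act : X -> G -> X)
    (p : G) (f : X -> R[i]^o) : X -> R[i]^o :=
  fun x => if (x, p) \in Gamma then f (act x p) else 0.

(* Main.v *)
Require Import Defs.
From HB Require Import structures.
From mathcomp Require Import all_boot all_order all_algebra complex.
From mathcomp Require Import all_classical all_reals all_analysis.

Import numFieldNormedType.Exports.

(** Write [C] for the support of [f].  The map [y |-> y . p^-1] is defined on
    [C] by hypothesis, and [act_mulVK] and [act_mulKV] say that it is inverse to
    [x |-> x . p]; hence the set [S] of points [x] with [(x, p)] in [Gamma] and
    [x . p] in [C] is the translate [C . p^-1] ([pullback_image]).  Both
    partial maps are continuous at the points where they are defined, because
    [Gamma] is open.  So [S] is compact, and closed as [X] is Hausdorff.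

    Closedness of [S] is what makes the extension by zero continuous: the two
    open sets [{x | (x, p) in Gamma}] and the complement of [S] cover [X], and
    [p . f] is [x |-> f (x . p)] on the first and [0] on the second.  It also
    bounds the support of [p . f] by [S].  Conversely a point [y . p^-1] of [S],
    with [y] in [C], is a limit of points [z . p^-1] with [f z != 0], and [p . f]
    takes the value [f z] there. *)

Local Open Scope classical_set_scope.
Local Open Scope complex_scope.
Local Open Scope ring_scope.

Section LocalAction.
Context {X : topologicalType} {G : topologicalGroupType}.
Context {Gamma : set (X * G)} {act : X -> G -> X}.
Hypothesis Hact : local_right_action Gamma act.

Lemma cvg_pair_cst (x : X) (p : G) : (y, p) @[y --> x] --> (x, p).
Proof. by apply: cvg_pair; [exact: cvg_id | exact: cvg_cst]. Qed.

Lemma near_dom (x : X) (p : G) : Gamma (x, p) -> \forall y \near x, Gamma (y, p).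
Proof.
move=> xp; apply: (cvg_pair_cst x p).
by apply: open_nbhs_nbhs; split=> //; exact: lra_open Hact.
Qed.

(** Continuity within [Gamma] is continuity at each point of [Gamma], since
    [Gamma] is open; it then passes to the slice at [p]. *)
Lemma act_continuous (x : X) (p : G) :
  Gamma (x, p) -> {for x, continuous (act^~ p)}.
Proof.
move=> xp; have := lra_continuous Hact.
rewrite (continuous_open_subspace _ (lra_open Hact)) => /(_ _ (mem_set xp)).
exact: cvg_comp (cvg_pair_cst x p).
Qed.

Lemma act_domV (x : X) (p : G) : Gamma (x, p) -> Gamma (act x p, p^-1%g).
Proof.
move=> xp; apply: (lra_domM Hact p^-1%g xp).1.
by rewrite mulgV; exact: lra_dom1 Hact x.
Qed.

Lemma act_mulKV (x : X) (p : G) :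
  Gamma (x, p) -> act (act x p) p^-1%g = x.
Proof.
move=> xp; rewrite -(lra_actM Hact) ?mulgV ?(lra_act1 Hact) //.
exact: lra_dom1 Hact x.
Qed.

Lemma act_dom (x : X) (p : G) : Gamma (x, p^-1%g) -> Gamma (act x p^-1%g, p).
Proof. by move=> /act_domV; rewrite invgK. Qed.

Lemma act_mulVK (x : X) (p : G) :
  Gamma (x, p^-1%g) -> act (act x p^-1%g) p = x.
Proof. by move=> /act_mulKV; rewrite invgK. Qed.

Lemma pullback_image (C : set X) (p : G) :
  (forall x, C x -> Gamma (x, p^-1%g)) ->
  [set x | Gamma (x, p) /\ C (act x p)] = act^~ p^-1%g @` C.
Proof.
move=> Cp; apply/seteqP; split=> [x [xp Cxp]|_ [y Cy <-]] /=.
  by exists (act x p) => //; exact: act_mulKV.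
by split; [exact: act_dom (Cp y Cy) | rewrite act_mulVK //; exact: Cp].
Qed.

Lemma pullback_compact (C : set X) (p : G) :
  (forall x, C x -> Gamma (x, p^-1%g)) -> compact C ->
  compact [set x | Gamma (x, p) /\ C (act x p)].
Proof.
move=> Cp cptC; rewrite pullback_image//; apply: continuous_compact => //.
apply: continuous_in_subspaceT => x /set_mem Cx; exact: act_continuous (Cp x Cx).
Qed.

End LocalAction.

Section Translate.
Context {R : realType} {X : topologicalType} {G : topologicalGroupType}.
Context {Gamma : set (X * G)} {act : X -> G -> X}.
Hypothesis Hact : local_right_action Gamma act.

Lemma translateE (f : X -> R[i]^o) (p : G) (x : X) :
  Gamma (x, p) -> translate Gamma act p f x = f (act x p).
Proof. by move=> xp; rewrite /translate mem_set. Qed.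

Lemma translate_neq0 (f : X -> R[i]^o) (p : G) (x : X) :
  translate Gamma act p f x != 0 -> Gamma (x, p) /\ f (act x p) != 0.
Proof.
by rewrite /translate; case: ifPn => [/set_mem //|_]; rewrite eqxx.
Qed.

Lemma translate_continuous (f : X -> R[i]^o) (p : G) :
  continuous f -> closed [set x | Gamma (x, p) /\ supp f (act x p)] ->
  continuous (translate Gamma act p f).
Proof.
move=> cf clS x; have [xp|xNp] := pselect (Gamma (x, p)).
  have cfp : {for x, continuous (f \o act^~ p)}.
    by apply: continuous_comp; [exact: act_continuous Hact _ _ xp | exact: cf].
  rewrite /prop_for /continuous_at translateE //.
  apply: cvg_trans cfp; apply: near_eq_cvg.
  by near do rewrite translateE //; exact: near_dom Hact _ _ xp.
have NSx : (~` [set x | Gamma (x, p) /\ supp f (act x p)]) x by case.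
have near0 : \forall y \near x, translate Gamma act p f y = 0.
  apply: filterS (open_nbhs_nbhs (conj (closed_openC clS) NSx)) => y NSy.
  apply/eqP/negP => /negP/translate_neq0 [yp fyp]; apply: NSy; split=> //.
  exact: subset_closure.
rewrite /continuous_at (nbhs_singleton near0).
by apply: cvg_near_cst.
Unshelve. all: by end_near. Qed.

Lemma supp_translate (f : X -> R[i]^o) (p : G) :
  (forall x, supp f x -> Gamma (x, p^-1%g)) ->
  closed [set x | Gamma (x, p) /\ supp f (act x p)] ->
  supp (translate Gamma act p f) =
    [set x | Gamma (x, p) /\ supp f (act x p)].
Proof.
move=> Hp clS; apply/seteqP; split.
  rewrite [X in _ `<=` X](closure_id _).1 //; apply: closure_subset => x.
  move=> /translate_neq0 [xp fxp]; split=> //; exact: subset_closure.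
rewrite (pullback_image Hact) // => _ [y Cy <-] U Uyp.
have yp := Hp _ Cy.
have near_y : \forall z \near y, Gamma (z, p^-1%g) /\ U (act z p^-1%g).
  apply: filterI; first exact: near_dom Hact _ _ yp.
  exact: act_continuous Hact _ _ yp _ Uyp.
have [z [fz [zp Uz]]] := Cy _ near_y.
exists (act z p^-1%g); split=> //=.
by rewrite translateE ?(act_mulVK Hact) //; exact: act_dom Hact _ _ zp.
Qed.

End Translate.

Theorem proposition2p1 (R : realType) (X : topologicalType)
    (G : topologicalGroupType)
    (X_hausdorff : hausdorff_space X) (X_lc : locally_compact [set: X])
    (G_hausdorff : hausdorff_space G) (G_lc : locally_compact [set: G])
    (Gamma : set (X * G)) (act : X -> G -> X)
    (Hact : local_right_action Gamma act)
    (f : X -> R[i]^o) (f_Cc : Cc f) (p : G)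
    (Hp : forall x, supp f x -> Gamma (x, (p^-1)%g)) :
  Cc (translate Gamma act p f) /\
  supp (translate Gamma act p f) = [set x | Gamma (x, p) /\ supp f (act x p)].
Proof.
have [cf cptC] := f_Cc.
have cptS := pullback_compact Hact _ _ Hp cptC.
have clS := compact_closed X_hausdorff cptS.
have suppE := supp_translate Hact _ _ Hp clS.
by split=> //; split; [exact: translate_continuous | rewrite suppE].
Qed.
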